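(* Let $L$ be a well-separated completely semidistributive lattice, let $A$ be a set of completely join-irreducible elements of $L$ and let $x=\bigvee A$. Then the following are equivalent. (1) $A$ joins canonically, i.e. $x=\bigvee A$ is the canonical join representation of $x$. (2) $\bigvee A$ is an irredundant join representation of $x$ which refines every other irredundant join representation of $x$. (3) For all $i\ne j$ in $A$, one has $i\le\kappa(j)$. (4) $A$ is an antichain and every $j\in A$ labels a cover relation of the form $u\lessdot x$. Moreover, if (1)-(4) hold, then $A$ is precisely the set of elements which label cover relations of the form $u\lessdot x$.
   Context: $L$ is a complete lattice with least element $\hat 0$ and greatest element $\hat 1$; $\bigvee\emptyset=\hat0$, $\bigwedge\emptyset=\hat1$. An element $j$ is completely join-irreducible if $j=\bigvee X$ with $X\subseteq L$ implies $j\in X$; then $j$ covers a unique element $j_*$. $L$ is completely semidistributive if for all $x,w\in L$ and nonempty $Y\subseteq L$: if $x\vee y=w$ for all $y\in Y$ then $x\vee\bigwedge Y=w$, and if $x\wedge y=w$ for all $y\in Y$ then $x\wedge\bigvee Y=w$. In such a lattice, for each completely join-irreducible $j$ the maximum $\kappa(j)=\max\{y\in L\mid j\wedge y=j_*\}$ exists. $L$ is well-separated if for all $x\not\le y$ in $L$ there is a completely join-irreducible $j$ with $j\le x$ and $y\le\kappa(j)$. The label of a cover relation $u\lessdot v$ is the completely join-irreducible element $\min\{y\in L\mid y\vee u=v\}$ (which exists). A join representation of $x$ is an equation $x=\bigvee A$, $A\subseteq L$; it is irredundant if $x\ne\bigvee(A\setminus\{j\})$ for all $j\in A$. Given $x=\bigvee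 A=\bigvee B$, $\bigvee A$ refines $\bigvee B$ if every $a\in A$ satisfies $a\le b$ for some $b\in B$. A join representation $x=\bigvee A$ is canonical if $A$ is an antichain and $\bigvee A$ refines every join representation of $x$. *)

(* Defs.v *)
From mathcomp Require Import all_boot all_order.
From mathcomp Require Import mathcomp_extra boolp classical_sets.

Set Implicit Arguments.
Unset Strict Implicit.
Unset Printing Implicit Defensive.

Import Order.TTheory.
Local Open Scope classical_set_scope.
Local Open Scope order_scope.

Definition complete_lattice {d : Order.disp_t} (L : tbLatticeType d) : Prop :=
  forall X : set L, supremums X !=set0 /\ infimums X !=set0.

(* [supremum x0] and [infimum x0] return the default [x0] on the empty set,
   which is why the defaults are the bottom and the top respectively. *)
Definition lsup {d : Order.disp_t} {L : tbLatticeType d} (X : set L) : L :=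
  supremum \bot X.

Definition linf {d : Order.disp_t} {L : tbLatticeType d} (X : set L) : L :=
  infimum \top X.

Section Elements.
Context {d : Order.disp_t} {L : tbLatticeType d}.
Implicit Types (X A B : set L) (u v w x y j : L).

Definition greatest_elements X : set L := X `&` ubound X.
Definition least_elements X : set L := X `&` lbound X.

Definition covers u v : Prop := u < v /\ forall w, ~ (u < w /\ w < v).

Definition completely_join_irreducible j : Prop :=
  forall X, j = lsup X -> X j.

(* In [lower_star], [kappa] and [label] the default \bot of [xget] is only
   returned when the described element does not exist; see [lower_starP],
   [kappaP] and [labelP] below. *)
Definition lower_star j : L := xget \bot [set u | covers u j].

Definition kappa j : L :=
  xget \bot (greatest_elements [set y | j `&` y = lower_star j]).

Definition label u v : L := xget \bot (least_elements [set y | y `|` u = v]).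

Definition labels_below x : set L := [set j | exists2 u, covers u x & label u x = j].

Definition antichain A : Prop :=
  forall a b, A a -> A b -> a <= b -> a = b.

Definition join_representation x A : Prop := x = lsup A.

Definition irredundant_join_representation x A : Prop :=
  join_representation x A /\ forall j, A j -> x <> lsup (A `\ j).

Definition refines A B : Prop :=
  forall a, A a -> exists2 b, B b & a <= b.

Definition canonical_join_representation x A : Prop :=
  [/\ join_representation x A, antichain A &
      forall B, join_representation x B -> refines A B].

End Elements.

Definition completely_semidistributive {d : Order.disp_t}
    (L : tbLatticeType d) : Prop :=
  forall (x w : L) (Y : set L), Y !=set0 ->
    ((forall y, Y y -> x `|` y = w) -> x `|` linf Y = w) /\
    ((forall y, Y y -> x `&` y = w) -> x `&` lsup Y = w).

Definition well_separated {d : Order.disp_t} (L : tbLatticeType d) : Prop :=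
  forall x y : L, ~~ (x <= y) ->
    exists j : L, [/\ completely_join_irreducible j, j <= x & y <= kappa j].

Section WellDefined.
Context {d : Order.disp_t} {L : tbLatticeType d}.
Implicit Types (X : set L) (u v j : L).

Lemma lsupP X : complete_lattice L -> supremums X (lsup X).
Proof.
move=> /(_ X)[[s Xs] _]; rewrite /lsup /supremum; case: ifPn => [/eqP->|_].
  by split=> [y []|y _]; exact: le0x.
exact: (xgetI _ Xs).
Qed.

Lemma linfP X : complete_lattice L -> infimums X (linf X).
Proof.
move=> /(_ X)[_ [s Xs]]; rewrite /linf /infimum; case: ifPn => [/eqP->|_].
  by split=> [y []|y _]; exact: lex1.
exact: (xgetI _ Xs).
Qed.

Lemma lower_star_exists j : complete_lattice L ->
  completely_join_irreducible j ->
  exists2 u, covers u j & forall w, w < j -> w <= u.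
Proof.
move=> cL jirr; pose X := [set w | w < j].
have [Xub Xlub] := lsupP X cL.
have Xj : lsup X <= j by apply: Xlub => y; exact: ltW.
have Xltj : lsup X < j.
  rewrite lt_neqAle Xj andbT; apply/eqP => e.
  by have := jirr X (esym e); rewrite /X /= ltxx.
exists (lsup X); last by move=> w /Xub.
split=> // w [uw wj].
by have := lt_le_trans uw (Xub w wj); rewrite ltxx.
Qed.

Lemma lower_starP j : complete_lattice L -> completely_join_irreducible j ->
  covers (lower_star j) j /\ forall u, covers u j -> u = lower_star j.
Proof.
move=> cL jirr; have [u0 cu0 u0max] := lower_star_exists cL jirr.
have uniq u : covers u j -> u = u0.
  move=> [uj nu]; have := u0max _ uj; rewrite le_eqVlt => /orP[/eqP //|uu0].
  by case: (nu u0); split=> //; case: cu0.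
have cs : covers (lower_star j) j by exact: (xgetI _ (cu0 : [set u | covers u j] u0)).
by split=> // u cu; rewrite (uniq u cu) (uniq _ cs).
Qed.

Lemma kappaP j : complete_lattice L -> completely_semidistributive L ->
  completely_join_irreducible j ->
  greatest_elements [set y | j `&` y = lower_star j] (kappa j).
Proof.
move=> cL sL jirr; set Y := [set y | _].
have [[/ltW sj _] _] := lower_starP cL jirr.
have Ys : Y (lower_star j) by exact/meet_r.
have [_ /(_ (fun y Yy => Yy)) Ysup] := sL j (lower_star j) Y (ex_intro _ _ Ys).
apply: (xgetI _ (_ : greatest_elements Y (lsup Y))).
by split=> //; have [] := lsupP Y cL.
Qed.

Lemma labelP u v : complete_lattice L -> completely_semidistributive L ->
  covers u v ->
  least_elements [set y | y `|` u = v] (label u v) /\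
  completely_join_irreducible (label u v).
Proof.
move=> cL sL [uv nuv]; set Y := [set y | _].
have Yv : Y v by exact/join_l/ltW.
have [Yinf _] := sL u v Y (ex_intro _ _ Yv).
have lP : least_elements Y (label u v).
  apply: (xgetI _ (_ : least_elements Y (linf Y))).
  split; last by have [] := linfP Y cL.
  by rewrite /Y /= joinC; apply: Yinf => y; rewrite /Y /= joinC.
split=> // X eX; have [lub llub] := lsupP X cL; have [Yl lmin] := lP.
rewrite -eX in lub llub.
apply: contrapT => nXl.
have : label u v <= u.
  apply: llub => y Xy; have yl := lub y Xy.
  have yuv : y `|` u <= v by rewrite leUx (ltW uv) andbT -Yl (le_trans yl) ?leUl.
  have : u <= y `|` u by exact: leUr.
  rewrite [u <= _]le_eqVlt => /orP[/eqP e|uyu]; first by rewrite e leUl.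
  move: yuv; rewrite [_ <= v]le_eqVlt => /orP[/eqP e|yuv]; last by case: (nuv (y `|` u)).
  have e' : y = label u v by apply/eqP; rewrite eq_le yl (lmin y).
  by case: nXl; rewrite -e'.
by move=> lu; move: uv; rewrite -Yl (join_r lu) ltxx.
Qed.

End WellDefined.

(* Main.v *)
Require Import Defs.
From mathcomp Require Import all_boot all_order.
From mathcomp Require Import mathcomp_extra boolp classical_sets.
Import Order.TTheory.
Local Open Scope classical_set_scope.
Local Open Scope order_scope.

(** The implication (2) => (3) rests on an exchange: if [i] is not below
    [kappa j], then [j <= i `|` j_*], so [j] may be replaced by [j_*] in the
    join, and the new representation is again irredundant but not refined by
    [A].  For (3) => (4), the meet of [x] and [kappa j] is a lower cover of [x]
    with label [j].  For (4) => (1), if [j] labels [u <. x] and [x] is the join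
    of [B], then some [b] in [B] is not below [u], so [b `|` u = x] and [j <= b]
    by minimality of the label.  Finally, two distinct lower covers of [x] form
    a join representation of [x], which the canonical one refines; hence no
    further labels occur. *)

Section CompleteLattice.
Set Implicit Arguments.
Unset Strict Implicit.
Context {d : Order.disp_t} {L : tbLatticeType d}.
Hypothesis hL : complete_lattice L.
Implicit Types (X A B : set L) (a b i j u w x y : L).

Lemma le_lsup X y : X y -> y <= lsup X.
Proof. by have [ub _] := lsupP X hL; exact: ub. Qed.

Lemma lsup_le X y : (forall a, X a -> a <= y) -> lsup X <= y.
Proof. by have [_ lub] := lsupP X hL; exact: lub. Qed.

Lemma lsup_nleP X y : ~~ (lsup X <= y) -> exists2 b, X b & ~~ (b <= y).
Proof.
move=> Xy; apply: contrapT => nb; move/negP: Xy; apply.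
by apply: lsup_le => a Xa; apply: contrapT => /negP ay; apply: nb; exists a.
Qed.

Lemma covers_join u x b : covers u x -> b <= x -> ~~ (b <= u) -> b `|` u = x.
Proof.
move=> [ux nux] bx bu; apply/eqP; rewrite eq_le leUx bx (ltW ux) /=.
have ubu : u < b `|` u.
  by rewrite lt_neqAle leUr andbT; apply: contra bu => /eqP e; rewrite [leRHS]e leUl.
apply: contrapT => /negP xbu; apply: (nux (b `|` u)); split=> //.
by rewrite lt_leAnge xbu leUx bx (ltW ux).
Qed.

Lemma le_lower_star j w : completely_join_irreducible j -> w < j -> w <= lower_star j.
Proof.
move=> jirr wj; have [u cu umax] := lower_star_exists hL jirr.
by have [_ /(_ u cu) <-] := lower_starP hL jirr; exact: umax.
Qed.

(** An element of [A] lying below another one can be deleted without changing the join. *)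
Lemma irredundant_antichain x A : irredundant_join_representation x A -> antichain A.
Proof.
move=> [xA irr] a b Aa Ab ab; apply: contrapT => ne; apply: (irr a Aa).
apply/eqP; rewrite xA eq_le; apply/andP; split; apply: lsup_le => c.
  have [-> _|ca Ac] := pselect (c = a); last exact: le_lsup.
  by apply: le_trans ab _; apply: le_lsup; split=> // /esym.
by move=> [Ac _]; exact: le_lsup.
Qed.

Lemma canonical_irredundant x A :
  canonical_join_representation x A -> irredundant_join_representation x A.
Proof.
move=> [xA anti ref]; split=> // j Aj /ref /(_ j Aj)[b [Ab bj] jb].
by apply: bj; exact/esym/anti.
Qed.

End CompleteLattice.

Section Semidistributive.
Set Implicit Arguments.
Unset Strict Implicit.
Context {d : Order.disp_t} {L : tbLatticeType d}.
Hypotheses (hL : complete_lattice L) (hsd : completely_semidistributive L).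
Implicit Types (X A B : set L) (a b i j u w x y : L).

Lemma lower_star_le_kappa j : completely_join_irreducible j -> lower_star j <= kappa j.
Proof. by move=> /(kappaP hL hsd)[<- _]; rewrite leIr. Qed.

Lemma lower_star_lt j : completely_join_irreducible j -> lower_star j < j.
Proof. by move=> /(lower_starP hL)[[]]. Qed.

Lemma nle_kappa j : completely_join_irreducible j -> ~~ (j <= kappa j).
Proof.
move=> jirr; apply/negP => /meet_l e; have := lower_star_lt jirr.
by have [<- _] := kappaP hL hsd jirr; rewrite e ltxx.
Qed.

(** If [j] is not below [w], their meet is strictly below [j], hence equal to [lower_star j], and
    the maximality of [kappa j] gives [w <= kappa j]. *)
Lemma le_of_nle_kappa j w : completely_join_irreducible j ->
  lower_star j <= w -> ~~ (w <= kappa j) -> j <= w.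
Proof.
move=> jirr sw wk; apply: contrapT => /negP jw; move/negP: wk; apply.
have [_ kmax] := kappaP hL hsd jirr; apply: kmax => /=.
apply/eqP; rewrite eq_le lexI sw (ltW (lower_star_lt jirr)) !andbT.
apply: (le_lower_star hL jirr); rewrite lt_neqAle leIl andbT.
by apply: contra jw => /eqP e; rewrite -[leLHS]e leIr.
Qed.

Lemma label_join u x : covers u x -> label u x `|` u = x.
Proof. by move=> /(labelP hL hsd)[[]]. Qed.

Lemma label_le u x b : covers u x -> b `|` u = x -> label u x <= b.
Proof. by move=> /(labelP hL hsd)[[_ lmin] _]; exact: lmin. Qed.

Lemma label_nle u x : covers u x -> ~~ (label u x <= u).
Proof.
move=> cu; apply/negP => lu; have := label_join cu; rewrite (join_r lu) => ux.
by case: cu; rewrite ux ltxx.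
Qed.

Lemma label_refines u x B : covers u x -> join_representation x B ->
  exists2 b, B b & label u x <= b.
Proof.
move=> cu xB; have : ~~ (lsup B <= u) by rewrite -xB lt_geF //; case: cu.
move=> /(lsup_nleP hL)[b Bb bu]; exists b => //; apply: label_le => //.
by apply: (covers_join cu) => //; rewrite xB; exact: le_lsup.
Qed.

Lemma irredundant_le_kappa x A :
  (forall j, A j -> completely_join_irreducible j) ->
  irredundant_join_representation x A ->
  (forall B, B <> A -> irredundant_join_representation x B -> refines A B) ->
  forall i j, A i -> A j -> i <> j -> i <= kappa j.
Proof.
move=> hA irrA ref i j Ai Aj ij; apply: contrapT => /negP ik.
have anti := irredundant_antichain hL irrA; have [xA irr] := irrA.
have jirr := hA j Aj; have sj := lower_star_lt jirr.
(* This makes the exchanged set [B] below different from [A]. *)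
have nAs : ~ A (lower_star j).
  by move=> As; have := anti _ _ As Aj (ltW sj) => e; rewrite e ltxx in sj.
pose B : set L := (A `\ j) `|` [set lower_star j].
have Bx b : B b -> b <= x.
  rewrite xA; move=> [[Ab _]|->]; first exact: le_lsup.
  by apply: le_trans (ltW sj) _; exact: le_lsup.
have jB : j <= lsup B.
  apply: (@le_trans _ _ (i `|` lower_star j)).
    apply: le_of_nle_kappa => //; first exact: leUr.
    by apply: contra ik; apply: le_trans; exact: leUl.
  by rewrite leUx !(le_lsup hL) //; [right|left].
have xB : x = lsup B.
  apply/eqP; rewrite eq_le (lsup_le hL Bx) andbT xA; apply: lsup_le => // a Aa.
  by have [->//|aj] := pselect (a = j); apply: le_lsup => //; left.
have irrB : irredundant_join_representation x B.
  split=> // b [[Ab bj]|->] e.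
  (* Removing [b] from [B] leaves elements bounded by the join of [A] without [b], since [j] stays
     there and bounds [lower_star j]. *)
  - apply: (irr b Ab); apply/eqP; rewrite eq_le; apply/andP; split.
      rewrite {1}e; apply: lsup_le => // c [[[Ac _]|->] cb].
        exact: le_lsup.
      by apply: le_trans (ltW sj) _; apply: le_lsup => //; split=> // /esym.
    by rewrite xA; apply: lsup_le => // c [Ac _]; exact: le_lsup.
  (* Removing [lower_star j] from [B] leaves only elements of [A] other than [j]. *)
  - apply: (irr j Aj); apply/eqP; rewrite eq_le; apply/andP; split.
      by rewrite {1}e; apply: lsup_le => // c [[Ac|//] _]; exact: le_lsup.
    by rewrite xA; apply: lsup_le => // c [Ac _]; exact: le_lsup.
have nBA : B <> A by move=> e; apply: nAs; rewrite -e; right.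
have [b [[Ab bj]|->] jb] := ref B nBA irrB j Aj.
- by apply: bj; exact/esym/anti.
- by have := le_lt_trans jb sj; rewrite ltxx.
Qed.

(** Distinct [a <= b] in [A] would give [a <= b <= kappa a], against [nle_kappa]. *)
Lemma le_kappa_antichain A :
  (forall j, A j -> completely_join_irreducible j) ->
  (forall i j, A i -> A j -> i <> j -> i <= kappa j) -> antichain A.
Proof.
move=> hA hk a b Aa Ab ab; apply: contrapT => ne.
move/negP: (nle_kappa (hA a Aa)); apply; apply: le_trans ab _.
by apply: hk => // /esym.
Qed.

Lemma le_kappa_labels_below A j : completely_join_irreducible j -> A j ->
  (forall i, A i -> i <> j -> i <= kappa j) -> labels_below (lsup A) j.
Proof.
move=> jirr Aj hk; set x := lsup A; pose u := x `&` kappa j.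
have jx : j <= x by exact: le_lsup.
have su : lower_star j <= u.
  by rewrite lexI lower_star_le_kappa // andbT (le_trans _ jx) ?ltW ?lower_star_lt.
(* All elements of [A] other than [j] lie below both [x] and [kappa j], hence below [u]; so [x] is
   the join of [u] and [j]. *)
have xw w : u <= w -> j <= w -> x <= w.
  move=> uw jw; apply: lsup_le => // a Aa; have [->//|aj] := pselect (a = j).
  by apply: le_trans _ uw; rewrite lexI (le_lsup hL) // hk.
have xu : ~~ (x <= u).
  by apply: contra (nle_kappa jirr) => xu; rewrite (le_trans jx) // (le_trans xu) ?leIr.
have cu : covers u x.
  split=> [|w [uw wx]]; first by rewrite lt_leAnge leIl xu.
  (* An element strictly between [u] and [x] escapes [kappa j], so it lies above [j] and then above
     [x]. *)
  have wk : ~~ (w <= kappa j).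
    apply/negP => wk; have : w <= u by rewrite lexI (ltW wx).
    by move=> wu; have := lt_le_trans uw wu; rewrite ltxx.
  have jw : j <= w by apply: le_of_nle_kappa => //; exact: le_trans su (ltW uw).
  by have := le_lt_trans (xw w (ltW uw) jw) wx; rewrite ltxx.
exists u => //; have ju : j `|` u = x.
  by apply/eqP; rewrite eq_le leUx jx leIl xw ?leUl ?leUr.
(* A label strictly below [j] would lie below [lower_star j], hence below [u], which no label of
   this cover does. *)
have := label_le cu ju; rewrite le_eqVlt => /orP[/eqP //|lj].
have := le_trans (le_lower_star hL jirr lj) su.
by rewrite (negPf (label_nle cu)).
Qed.

Lemma labels_below_canonical x A : join_representation x A -> antichain A ->
  (forall j, A j -> labels_below x j) -> canonical_join_representation x A.
Proof.
by move=> xA anti lab; split=> // B xB a /lab[u cu <-]; exact: label_refines.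
Qed.

Lemma canonical_labels_below_eq x A : canonical_join_representation x A ->
  (forall j, A j -> labels_below x j) -> A = labels_below x.
Proof.
move=> [xA _ ref] lab; apply/seteqP; split=> // j [u cu <-{j}].
have [a Aa la] := label_refines cu xA.
have [ua cua ea] := lab a Aa.
have [<-|ne] := eqVneq ua u; first by rewrite ea.
have au : ~~ (a <= u) by apply: contra (label_nle cu); exact: le_trans la.
have aua : ~~ (a <= ua) by rewrite -ea label_nle.
(* Distinct lower covers of [x] are incomparable, so their join is [x]. *)
have uau : ~~ (u <= ua).
  apply/negP => uua; case: (cu) => _ /(_ ua); apply; split; last by case: cua.
  by rewrite lt_neqAle eq_sym ne.
have xU : u `|` ua = x.
  by apply: (covers_join cua) => //; case: cu => /ltW.
(* Refinement of this pair puts [a] below [u] or [ua]; both are excluded by [au] and [aua]. *)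
have /ref /(_ a Aa)[b [] ->] : join_representation x [set u; ua].
- apply/eqP; rewrite eq_le; apply/andP; split.
    by rewrite -{1}xU leUx !(le_lsup hL) //; [right|left].
  by apply: lsup_le => // c [] ->; apply: ltW; [case: cu|case: cua].
- by rewrite (negPf au).
- by rewrite (negPf aua).
Qed.

End Semidistributive.

Theorem theorem6p3 (d : Order.disp_t) (L : tbLatticeType d)
    (hL : complete_lattice L) (hsd : completely_semidistributive L)
    (hws : well_separated L) (A : set L)
    (hA : forall j : L, A j -> completely_join_irreducible j)
    (x : L) (hx : x = lsup A) :
  [<-> canonical_join_representation x A;
       irredundant_join_representation x A /\
         (forall B : set L, B <> A -> irredundant_join_representation x B ->
            refines A B);
       (forall i j : L, A i -> A j -> i <> j -> i <= kappa j);
       antichain A /\ (forall j : L, A j -> labels_below x j)]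
  /\ (canonical_join_representation x A -> A = labels_below x).
Proof.
have h12 : canonical_join_representation x A ->
    irredundant_join_representation x A /\
    (forall B, B <> A -> irredundant_join_representation x B -> refines A B).
  move=> can; split; first exact: canonical_irredundant.
  by move=> B _ [xB _]; case: can => _ _; exact.
have h23 : irredundant_join_representation x A /\
      (forall B, B <> A -> irredundant_join_representation x B -> refines A B) ->
    forall i j, A i -> A j -> i <> j -> i <= kappa j.
  by move=> [irr ref]; exact: irredundant_le_kappa hA irr ref.
have h34 : (forall i j, A i -> A j -> i <> j -> i <= kappa j) ->
    antichain A /\ (forall j, A j -> labels_below x j).
  move=> hk; split=> [|j Aj]; first exact: le_kappa_antichain hA hk.
  rewrite hx; apply: le_kappa_labels_below => // [|i Ai]; first exact: hA.
  exact: hk.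
(* The final claim needs every element of [A] to be a label, which the chain from (1) to (4)
   supplies; the cycle is then closed by (4) => (1). *)
split; last first.
  move=> can; apply: canonical_labels_below_eq => //.
  by have [] := h34 (h23 (h12 can)).
tfae=> // -[anti lab]; exact: labels_below_canonical.
Qed.
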